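(* Let $\lambda\in B(0,1)\setminus\mathbb R$, and let $f_0(z)=2z+z^2$ and $f_1(z)=\lambda\dfrac{z}{(z+1)^2}$, viewed as rational maps of the Riemann sphere $\widehat{\mathbb C}$. Let $G=\langle f_0,f_1\rangle$ be the semigroup generated by $f_0$ and $f_1$ under composition. Let $z_0\in\mathbb C\setminus\{-1,0,\infty\}$. Then the $G$-orbit of $z_0$ is dense in $\widehat{\mathbb C}$.
   Context: $B(0,1)=\{z\in\mathbb C:|z|<1\}$. The $G$-orbit of $z_0$ is $\{g(z_0):g\in G\}$. *)

(* Defs.v *)
From HB Require Import structures.
From mathcomp Require Import all_boot all_order all_algebra.
From mathcomp Require Import all_classical all_reals all_analysis.
From mathcomp Require Import complex.

Set Implicit Arguments.
Unset Strict Implicit.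
Unset Printing Implicit Defensive.

Import Order.TTheory GRing.Theory Num.Theory.
Import numFieldNormedType.Exports.

Local Open Scope classical_set_scope.
Local Open Scope ring_scope.
Local Open Scope complex_scope.

(* The regular module [R[i]^o] is used because it, unlike [R[i]], carries the
   topology induced by the modulus. The point at infinity is [None]. *)
Notation riemann_sphere R := (one_point_compactification (R[i]^o)).

(* The self-map of the sphere induced by the quotient p / q in lowest terms
   (it is meaningful only for p and q coprime). With d the larger of the two
   degrees, p / q tends at infinity to the quotient of the coefficients of
   degree d. *)
Definition rational_map (R : realType) (p q : {poly R[i]})
    (x : riemann_sphere R) : riemann_sphere R :=
  match x with
  | Some z => if q.[z] == 0 then None else Some (p.[z] / q.[z] : R[i])
  | None => let d := (maxn (size p) (size q)).-1 in
            if q`_d == 0 then None else Some (p`_d / q`_d : R[i])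
  end.

Inductive semigroup_generated (T : Type) (S : set (T -> T)) : (T -> T) -> Prop :=
  | semigroup_gen f : S f -> semigroup_generated S f
  | semigroup_comp f g : semigroup_generated S f -> semigroup_generated S g ->
      semigroup_generated S (f \o g).

Definition orbit_of (T : Type) (G : set (T -> T)) (x : T) : set T :=
  [set g x | g in G].

Definition f0 (R : realType) : riemann_sphere R -> riemann_sphere R :=
  rational_map (2%:P * 'X + 'X^2) 1.

Definition f1 (R : realType) (lambda : R[i]) : riemann_sphere R -> riemann_sphere R :=
  rational_map (lambda *: 'X) (('X + 1) ^+ 2).

Lemma f0_coprime (R : realType) : coprimep (2%:P * 'X + 'X^2 : {poly R[i]}) 1.
Proof. exact: coprimep1. Qed.

Lemma f1_coprime (R : realType) (lambda : R[i]) : lambda != 0 ->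
  coprimep (lambda *: 'X) (('X + 1) ^+ 2).
Proof.
move=> l0; rewrite coprimepZl// coprimep_expr//.
have -> : 'X + 1 = 'X - (-1)%:P :> {poly R[i]} by rewrite polyCN opprK.
by rewrite coprimep_XsubC rootX oppr_eq0 oner_eq0.
Qed.

Lemma f0E (R : realType) (z : R[i]) : f0 (Some z) = Some (2 * z + z ^+ 2 : R[i]).
Proof. by rewrite /f0 /= !hornerE oner_eq0 invr1 mulr1. Qed.

Lemma f0_infty (R : realType) : f0 (None : riemann_sphere R) = None.
Proof.
have s : size (2%:P * 'X + 'X^2 : {poly R[i]}) = 3%N.
  rewrite addrC size_polyDl size_polyXn// mul_polyC.
  by rewrite (leq_ltn_trans (size_scale_leq _ _))// size_polyX.
by rewrite /f0 /= s size_poly1 /= coef1 eqxx.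
Qed.

Lemma f1E (R : realType) (lambda z : R[i]) : z != -1 ->
  f1 lambda (Some z) = Some (lambda * (z / (z + 1) ^+ 2) : R[i]).
Proof.
move=> z1; rewrite /f1 /= !hornerE.
by rewrite expf_eq0 addr_eq0 (negbTE z1) andbF.
Qed.

Lemma f1_pole (R : realType) (lambda : R[i]) :
  f1 lambda (Some (-1 : R[i])) = None.
Proof. by rewrite /f1 /= !hornerE addNr expf_eq0 eqxx. Qed.

Lemma f1_infty (R : realType) (lambda : R[i]) :
  f1 lambda None = Some (0 : R[i]).
Proof.
have e : 'X + 1 = 'X - (-1)%:P :> {poly R[i]} by rewrite polyCN opprK.
have s : size (('X + 1) ^+ 2 : {poly R[i]}) = 3%N by rewrite e size_exp_XsubC.
have c : (('X + 1) ^+ 2 : {poly R[i]})`_2 = 1.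
  have /monicP : ('X + 1) ^+ 2 \is @monic R[i].
    by rewrite e monic_exp ?monicXsubC.
  by rewrite /lead_coef s.
have sl : (size (lambda *: 'X : {poly R[i]}) <= 3)%N.
  by rewrite (leq_trans (size_scale_leq _ _))// size_polyX.
rewrite /f1 /= s (maxn_idPr sl) /= c oner_eq0 coefZ coefX /=.
by rewrite mulr0 mul0r.
Qed.

(* Main.v *)
Require Import Defs.
From mathcomp Require Import all_boot all_order all_algebra.
From mathcomp Require Import all_classical all_reals all_analysis.
From mathcomp Require Import complex ring lra.
Import Order.TTheory GRing.Theory Num.Theory.
Import numFieldNormedType.Exports.
Local Open Scope classical_set_scope.
Local Open Scope ring_scope.
Local Open Scope complex_scope.

(* Near the common fixed point 0, f_0 is conjugate to multiplication by 2 and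
   f_1 to multiplication by lambda, but not simultaneously. Let T be the set of
   limits of 2^m y with m -> oo and y in the orbit. It is closed and invariant
   under multiplication by 2, 1/2, lambda and 1/lambda, the latter because
   2^m lambda^n returns arbitrarily close to 1. Along such returns, f_0^m f_1^n
   tends to the change of coordinates between the two linearizations, which is
   t + c t^2 + O(t^3) with c != 0. Conjugating it by 2^k lambda^(-j) shows that
   s + 2^(-k) c lambda^j s^2 + O(4^(-k)) lies in T for all s in T. As lambda is
   not real, the vectors c lambda^j s^2 positively span the plane, so a nearest
   point s in T to some p outside T could be improved: T is the whole plane
   except possibly 0. Finally f_0^m(y) + 1 = (1 + y)^(2^m), and iterated square
   roots bring any target close to 1, where it is hit up to a second-order
   error. *)

(** The norm [|z|] is itself an element of [R[i]]; a modulus valued in [R] makes estimates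
    accessible to real arithmetic. *)
Definition modulus {R : realType} (z : R[i]) : R := Normc.normc z.
Local Notation N := modulus.

(** * The modulus of complex numbers *)

Section Modulus.
Variable R : realType.
Implicit Types (x y z : R[i]).

Lemma modulus0 : N (0 : R[i]) = 0.
Proof. exact: Normc.normc0. Qed.

Lemma modulus1 : N (1 : R[i]) = 1.
Proof. exact: Normc.normc1. Qed.

Lemma normC_modulus x : `|x| = (N x)%:C.
Proof. by case: x => a b; rewrite normc_def. Qed.

Lemma modulus_ge0 x : 0 <= N x.
Proof. by case: x => a b; rewrite /modulus /= sqrtr_ge0. Qed.

Lemma modulusD_le x y : N (x + y) <= N x + N y.
Proof. exact: le_normcD. Qed.

Lemma modulusN x : N (- x) = N x.
Proof. exact: normcN. Qed.

Lemma modulusBC x y : N (x - y) = N (y - x).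
Proof. by rewrite -opprB modulusN. Qed.

Lemma modulusB_le x y : N (x - y) <= N x + N y.
Proof. by rewrite (le_trans (modulusD_le _ _))// modulusN. Qed.

Lemma modulus_tri y x z : N (x - z) <= N (x - y) + N (y - z).
Proof. by rewrite (_ : x - z = (x - y) + (y - z)) ?modulusD_le//; ring. Qed.

Lemma modulusB_ge x y : N x - N y <= N (x - y).
Proof. by rewrite lerBlDr; have := modulusD_le (x - y) y; rewrite subrK. Qed.

Lemma modulusD_ge x y : N x - N y <= N (x + y).
Proof. by rewrite -(modulusN y) -{2}(opprK y) modulusB_ge. Qed.

Lemma modulusM x y : N (x * y) = N x * N y.
Proof. exact: Normc.normcM. Qed.

Lemma modulusX x n : N (x ^+ n) = N x ^+ n.
Proof.
by elim: n => [|n IH]; rewrite ?expr0 ?modulus1// !exprS modulusM IH.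
Qed.

Lemma modulusV x : N x^-1 = (N x)^-1.
Proof. exact: Normc.normcV. Qed.

Lemma modulus_nat n : N (n%:R : R[i]) = n%:R.
Proof.
have : (N (n%:R : R[i]))%:C = (n%:R)%:C :> R[i].
  by rewrite -normC_modulus normr_nat rmorph_nat.
exact: fmorph_inj.
Qed.

Lemma modulus_eq0 x : (N x == 0) = (x == 0).
Proof.
by apply/eqP/eqP => [/Normc.eq0_normc //|->]; exact: modulus0.
Qed.

Lemma modulus_gt0 x : (0 < N x) = (x != 0).
Proof. by rewrite lt_def modulus_eq0 modulus_ge0 andbT. Qed.

Lemma modulus_sqr x : N x ^+ 2 = complex.Re x ^+ 2 + complex.Im x ^+ 2.
Proof. by case: x => a b; rewrite /modulus /= sqr_sqrtr// addr_ge0 ?sqr_ge0. Qed.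

Lemma Re_le_modulus x : `|complex.Re x| <= N x.
Proof.
by rewrite -(@ler_pXn2r _ 2)// ?nnegrE ?modulus_ge0// modulus_sqr real_normK ?num_real// lerDl sqr_ge0.
Qed.

Lemma Im_le_modulus x : `|complex.Im x| <= N x.
Proof.
by rewrite -(@ler_pXn2r _ 2)// ?nnegrE ?modulus_ge0// modulus_sqr real_normK ?num_real// lerDr sqr_ge0.
Qed.

Lemma modulus_le_ReIm x : N x <= `|complex.Re x| + `|complex.Im x|.
Proof.
rewrite -(@ler_pXn2r _ 2)// ?nnegrE ?modulus_ge0 ?addr_ge0// modulus_sqr.
rewrite sqrrD !real_normK ?num_real//.
by rewrite -addrA [X in _ <= _ + X]addrC addrA lerDl mulrn_wge0// mulr_ge0.
Qed.

(** Bolzano-Weierstrass: the pairs of real and imaginary parts stay in a compact square, and a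
    cluster point is approached at arbitrarily late indices. *)
Lemma bounded_seq_cluster (u : nat -> R[i]) (B : R) :
  (forall n, N (u n) <= B) ->
  exists s, forall eps M, 0 < eps -> exists2 n, (M <= n)%N & N (u n - s) < eps.
Proof.
move=> uB.
pose v n : R * R := (complex.Re (u n), complex.Im (u n)).
have cB := compact_setX (@segment_compact R (- B) B) (@segment_compact R (- B) B).
have vK : (v @ \oo) (`[-B, B]%classic `*` `[-B, B]%classic).
  exists 0%N => // n _; split => /=; rewrite in_itv/= -ler_norml (le_trans _ (uB n))//.
    exact: Re_le_modulus.
  exact: Im_le_modulus.
have [[a b] [_ cl]] := cB _ _ vK.
exists (Complex a b) => eps M e0.
have e20 : 0 < eps / 2 by lra.
have nb : nbhs ((a, b) : R * R) (ball (a, b) (eps / 2)) by exact: nbhsx_ballx.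
have tl : (v @ \oo) (v @` [set n | (M <= n)%N]).
  by exists M => // n /= Mn; exists n.
have [_ [[n /= Mn <-] [/= ha hb]]] := cl _ _ tl nb.
exists n => //.
rewrite (le_lt_trans (modulus_le_ReIm _))//.
move: ha hb; rewrite /ball/=.

rewrite distrC => ha; rewrite distrC => hb; move: ha hb.
by case: (u n) => c d /=; lra.
Qed.

End Modulus.

(** * Expansions of the generators at 0 *)

Section Estimates.
Variable R : realType.
Implicit Types (x y z : R[i]).

Lemma expr_lt_eps (q eps : R) : 0 <= q -> q < 1 -> 0 < eps ->
  exists n0, forall n, (n0 <= n)%N -> q ^+ n < eps.
Proof.
move=> q0 q1 e0.
have /cvgrPdist_lt /(_ _ e0) [n0 _ H] := @cvg_expr R q ltac:(by rewrite ger0_norm).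
exists n0 => n /H; rewrite sub0r normrN ger0_norm//; exact: exprn_ge0.
Qed.

Lemma exists_expn2_gt (B : R) : exists n0, forall n, (n0 <= n)%N -> B < 2 ^+ n.
Proof.
have B0 : 0 < (`|B| + 1)^-1 by rewrite invr_gt0; have := normr_ge0 B; lra.
have [||n0 H] := @expr_lt_eps 2^-1 _ _ _ B0; [lra|lra|].
have p : 0 < `|B| + 1 by have := normr_ge0 B; lra.
exists n0 => n /H; rewrite exprVn ltf_pV2 ?posrE ?exprn_gt0//.
by have := ler_norm B; lra.
Qed.

(** This and the next two estimates expand (1 + y)^n to successive orders, with bounds depending on
    n and y only through n |y|. Each follows by induction on n, the second and third using the
    preceding order. With n = 2^m they describe the iterates of f_0 near 0. *)
Lemma expD1_est1 y n : n%:R * N y <= 2^-1 ->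
  N ((1 + y) ^+ n - 1) <= 2 * (n%:R * N y).
Proof.
have y0 := modulus_ge0 _ y.
elim: n => [|n IH]; first by rewrite expr0 subrr modulus0 !mul0r mulr0.
rewrite -natr1 => h.
have nn : 0 <= n%:R :> R by [].
have {}IH := IH ltac:(nra).
rewrite (_ : _ - 1 = ((1 + y) ^+ n - 1) + (y + y * ((1 + y) ^+ n - 1))); last by rewrite exprS; ring.
have := modulusD_le _ ((1 + y) ^+ n - 1) (y + y * ((1 + y) ^+ n - 1)).
have := modulusD_le _ y (y * ((1 + y) ^+ n - 1)).
rewrite modulusM.
have : N y * N ((1 + y) ^+ n - 1) <= N y * 1 by apply: ler_wpM2l => //; nra.
by lra.
Qed.

Lemma expD1_est2 y n : n%:R * N y <= 2^-1 ->
  N ((1 + y) ^+ n - 1 - n%:R * y) <= (n%:R * N y) ^+ 2.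
Proof.
have y0 := modulus_ge0 _ y.
elim: n => [|n IH] hn.
  by rewrite expr0 subrr !mul0r subr0 modulus0 expr0n.
have nn : 0 <= n%:R :> R by [].
have hn' : n%:R * N y <= 2^-1.
  by move: hn; rewrite -natr1; nra.
have {}IH := IH hn'; have e1 := expD1_est1 _ _ hn'.
rewrite (_ : _ - _ = ((1 + y) ^+ n - 1 - n%:R * y) + y * ((1 + y) ^+ n - 1)); last by rewrite exprS -natr1; ring.
apply: (le_trans (modulusD_le _ _ _)); rewrite modulusM -natr1.
have : N y * N ((1 + y) ^+ n - 1) <= N y * (2 * (n%:R * N y)) by apply: ler_wpM2l.
move: IH; rewrite !expr2; nra.
Qed.

(** The quadratic term is binomial(n, 2) y^2, written through n y, which converges when n = 2^m
    grows. *)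
Lemma expD1_est3 y n : n%:R * N y <= 2^-1 ->
  N ((1 + y) ^+ n - 1 - n%:R * y - (n%:R * y) * (n%:R * y - y) / 2)
    <= (n%:R * N y) ^+ 3.
Proof.
have y0 := modulus_ge0 _ y.
elim: n => [|n IH] hn.
  by rewrite expr0 subrr !mul0r !subr0 modulus0 expr0n.
have nn : 0 <= n%:R :> R by [].
have hn' : n%:R * N y <= 2^-1.
  by move: hn; rewrite -natr1; nra.
have {}IH := IH hn'; have e1 := expD1_est2 _ _ hn'.
set L := (X in N X <= _).
rewrite (_ : L = ((1 + y) ^+ n - 1 - n%:R * y - (n%:R * y) * (n%:R * y - y) / 2) + y * ((1 + y) ^+ n - 1 - n%:R * y)); last by rewrite /L exprS -natr1; field.
apply: (le_trans (modulusD_le _ _ _)); rewrite modulusM -natr1.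
have : N y * N ((1 + y) ^+ n - 1 - n%:R * y) <= N y * (n%:R * N y) ^+ 2 by apply: ler_wpM2l.
(* This is the slack (n + 1)^3 - n^3 - n^2 in the induction, times |y|^3. *)
have : 0 <= N y ^+ 3 * (2 * n%:R ^+ 2 + 3 * n%:R + 1).
  by rewrite mulr_ge0 ?exprn_ge0// !addr_ge0// mulr_ge0// exprn_ge0.
move: IH; lra.
Qed.

Definition f0C z := 2 * z + z ^+ 2.
(** At the pole -1 the division returns 0 instead of infinity, so this is the action of f_1 only
    away from -1. *)
Definition f1C lam z : R[i] := lam * (z / (z + 1) ^+ 2).

Lemma iter_f0CE n z : iter n f0C z = (1 + z) ^+ (2 ^ n) - 1.
Proof.
elim: n => [|n IH]; first by rewrite expn0 expr1 /=; ring.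
rewrite iterS IH expnS mulnC exprM /f0C; ring.
Qed.

(** The remainder is exactly lam z^3 (3 + 2 z) / (z + 1)^2, where |3 + 2 z| <= 4 and |z + 1|^2 >=
    1/4. *)
Lemma f1C_est lam z : N z <= 2^-1 ->
  N (f1C lam z - lam * (z - 2 * z ^+ 2)) <= 16 * N lam * N z ^+ 3.
Proof.
move=> hz; have z0 := modulus_ge0 _ z.
have w2 : 2^-1 <= N (z + 1).
  by have := modulusD_ge _ 1 z; rewrite modulus1 (addrC 1 z); lra.
have w0 : z + 1 != 0 by rewrite -modulus_gt0; lra.
rewrite (_ : _ - _ = lam * z ^+ 3 * (3 + 2 * z) / (z + 1) ^+ 2); last by rewrite /f1C; field.
rewrite !modulusM modulusV !modulusX.
rewrite ler_pdivrMr ?exprn_gt0//; last by lra.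
have h : N (3 + 2 * z) <= 4.
  have := modulusD_le _ 3 (2 * z); rewrite modulusM !modulus_nat; lra.
have h2 : 4^-1 <= N (z + 1) ^+ 2 by rewrite expr2; nra.
have h3 : 0 <= N lam * N z ^+ 3 by rewrite mulr_ge0 ?exprn_ge0// modulus_ge0.
nra.
Qed.

End Estimates.
Arguments f0C {R}.
Arguments f1C {R}.

(** * The linearization of f_1 at 0 *)

Section Koenigs.
Variable R : realType.
Implicit Types (x y z : R[i]).
Variable lam : R[i].
Hypothesis lam0 : lam != 0.
Hypothesis lam1 : N lam < 1.

(* The linearization is z + kcoef * z^2 + O(z^3). *)
Definition kcoef : R[i] := - (2 / (1 - lam)).
Local Notation b := kcoef.

Lemma lam_neq1 : 1 - lam != 0.
Proof.
rewrite subr_eq0; apply/eqP => e; move: lam1; rewrite -e modulus1; lra.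
Qed.

(** The value of b is the one for which the quadratic terms cancel: -2 lam + b lam^2 = b lam. The
    factor |lam| in the bound pays for one division by lam when the estimate is iterated. *)
Lemma kcoef_functional_eq z : N z <= 2^-1 ->
  N ((f1C lam z + b * f1C lam z ^+ 2) - lam * (z + b * z ^+ 2))
    <= N lam * (16 + 70 * N b) * N z ^+ 3.
Proof.
move=> hz; have z0 := modulus_ge0 _ z; have l0 := modulus_ge0 _ lam.
have b0 := modulus_ge0 _ b.
have := f1C_est _ lam _ hz.
set G := f1C lam z; set e := G - _ => he.
have l1 := lam_neq1.
pose h := e / lam.
have eh : e = lam * h by rewrite /h mulrC divfK.
clearbody h.
have GE : G = lam * (z - 2 * z ^+ 2 + h) by rewrite mulrDr -eh /e; ring.
have hh : N h <= 16 * N z ^+ 3.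
  move: he; rewrite eh modulusM => {}he.
  have : 0 < N lam by rewrite modulus_gt0.
  by move=> lp; rewrite -(ler_pM2l lp); lra.
have -> : G + b * G ^+ 2 - lam * (z + b * z ^+ 2) =
   lam * (h + b * lam * ((h - 2 * z ^+ 2) * (2 * z - 2 * z ^+ 2 + h))).
  by rewrite GE /kcoef; field.
rewrite modulusM -[leRHS]mulrA ler_wpM2l//.
apply: (le_trans (modulusD_le _ _ _)).
rewrite !modulusM.
have z3 : 0 <= N z ^+ 3 by rewrite exprn_ge0.
have z2 : 0 <= N z ^+ 2 by rewrite exprn_ge0.
have zz3 : N z ^+ 3 <= N z ^+ 2 / 2 by rewrite exprSr; apply: ler_wpM2l.
have zz2 : N z ^+ 2 <= N z / 2 by rewrite expr2; apply: ler_wpM2l.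
have p1 : N (h - 2 * z ^+ 2) <= 10 * N z ^+ 2.
  have := modulusB_le _ h (2 * z ^+ 2); rewrite modulusM modulus_nat modulusX; lra.
have p2 : N (2 * z - 2 * z ^+ 2 + h) <= 7 * N z.
  have := modulusD_le _ (2 * z - 2 * z ^+ 2) h.
  have := modulusB_le _ (2 * z) (2 * z ^+ 2); rewrite !(modulusM _ 2) !modulus_nat modulusX; lra.
have p3 : N (h - 2 * z ^+ 2) * N (2 * z - 2 * z ^+ 2 + h) <= 70 * N z ^+ 3.
  rewrite (_ : 70 * N z ^+ 3 = (10 * N z ^+ 2) * (7 * N z)); last by ring.
  by apply: ler_pM => //; exact: modulus_ge0.
have : N b * N lam * (N (h - 2 * z ^+ 2) * N (2 * z - 2 * z ^+ 2 + h))
       <= N b * 1 * (70 * N z ^+ 3).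
  by apply: ler_pM => //; rewrite ?mulr_ge0 ?modulus_ge0// ler_wpM2l// ltW.
by move: hh; lra.
Qed.

(* With |lam| = s^2 and s < theta < 1, the map contracts near 0 by s * theta,
   whose square is smaller than |lam|: the quadratic terms die out. *)
Lemma koenigs_iter : exists theta r C : R,
  [/\ 0 < theta < 1, 0 < r <= 2^-1, 0 <= C &
   forall z, N z <= r -> forall n,
     N (iter n (f1C lam) z) <= N z /\
     N (lam ^- n * iter n (f1C lam) z - (z + b * z ^+ 2)) <=
       C * N z ^+ 3 + N b * theta ^+ n * N z ^+ 2].
Proof.
pose q := N lam; pose s := Num.sqrt q.
have q0 : 0 < q by rewrite modulus_gt0.
have s2 : s ^+ 2 = q by rewrite sqr_sqrtr// ltW.
have s0 : 0 < s by rewrite sqrtr_gt0.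
have s1 : s < 1.
  by rewrite -(@ltr_pXn2r _ 2)// ?nnegrE// ?ltW// s2 expr1n.
pose th := (1 + s) / 2.
have th1 : th < 1 by rewrite /th; lra.
have th0 : 0 < th by rewrite /th; lra.
have sth : s < th by rewrite /th; lra.
(* With this radius th (1 - 2 r) = ((1 + s) / 2)^2 >= s, which gives the contraction factor s th on
   the disc of radius r. *)
pose r := (1 - s) / 4.
have rp : 0 < r by rewrite /r; lra.
have r2 : r <= 2^-1 by rewrite /r; lra.
pose C1 := 16 + 70 * N b.
have C10 : 0 <= C1 by rewrite addr_ge0// mulr_ge0// modulus_ge0.
exists th, r, (C1 / (1 - th)); split; rewrite ?th0 ?rp//.
  by rewrite divr_ge0//; lra.
move=> z zr n; have z0 := modulus_ge0 _ z.
have contr x : N x <= r -> N (f1C lam x) <= s * th * N x.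
  move=> xr; have x0 := modulus_ge0 _ x.
  have w2 : 1 - r <= N (x + 1).
    by have := modulusD_ge _ 1 x; rewrite modulus1 (addrC 1 x); lra.
  have wp : 0 < N (x + 1) by lra.
  rewrite /f1C !modulusM modulusV modulusX mulrA ler_pdivrMr ?exprn_gt0//.
  rewrite -/q -s2.
  have h1 : (1 - r) ^+ 2 <= N (x + 1) ^+ 2.
    by rewrite ler_pXn2r ?nnegrE//; lra.
  have h2 : s <= th * (1 - r) ^+ 2.
    have : 1 - 2 * r <= (1 - r) ^+ 2 by have := sqr_ge0 r; lra.
    have : s <= th * (1 - 2 * r) by rewrite /th /r; nra.
    nra.
  have h3 : s <= th * N (x + 1) ^+ 2 by nra.
  have : 0 <= s * N x by rewrite mulr_ge0// ltW.
  by rewrite expr2; nra.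
have st1 : 0 <= s * th <= 1 by apply/andP; split; nra.
have iterN k : N (iter k (f1C lam) z) <= (s * th) ^+ k * N z.
  elim: k => [|k IH]; first by rewrite expr0 mul1r.
  rewrite iterS exprS -mulrA (le_trans (contr _ _))//.
    apply: (le_trans IH); rewrite (le_trans _ zr)// ler_piMl//.
    by rewrite exprn_ile1//; lra.
  by rewrite ler_wpM2l//; lra.
split.
  by rewrite (le_trans (iterN n))// ler_piMl// exprn_ile1//; lra.
pose P x : R[i] := x + b * x ^+ 2.
(* The differences telescope. As (s th)^3 <= q th, the k-th one is at most C1 th^k |z|^3, and the
   geometric sum appears on the right. *)
have main k : N (lam ^- k * P (iter k (f1C lam) z) - P z)
    <= C1 / (1 - th) * (1 - th ^+ k) * N z ^+ 3.
  elim: k => [|k IH].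
    by rewrite expr0 invr1 mul1r /= subrr modulus0 subrr mulr0 mul0r.
  set x := iter k _ z in IH *.
  rewrite iterS -/x.
  have xN := iterN k; rewrite -/x in xN.
  have xz : N x <= N z.
    by rewrite (le_trans xN)// ler_piMl// exprn_ile1//; lra.
  have step : N (lam ^- k.+1 * (P (f1C lam x) - lam * P x)) <= C1 * th ^+ k * N z ^+ 3.
    rewrite modulusM modulusV modulusX -/q.
    rewrite ler_pdivrMl ?exprn_gt0//.
    have := kcoef_functional_eq x ltac:(lra).
    move=> /le_trans; apply.
    rewrite -/C1 -/q (exprS q k).
    have x3 : N x ^+ 3 <= (s * th) ^+ k ^+ 3 * N z ^+ 3.
      rewrite -exprMn ler_pXn2r ?nnegrE ?modulus_ge0//.
      by rewrite mulr_ge0// exprn_ge0//; lra.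
    have : (s * th) ^+ k ^+ 3 <= q ^+ k * th ^+ k.
      rewrite -s2 -[leLHS]exprM mulnC exprM -[leRHS]exprMn.
      have a0 : 0 <= s ^+ 2 * th by rewrite mulr_ge0 ?exprn_ge0// ltW.
      apply: lerXn2r; rewrite ?nnegrE ?exprn_ge0//; first by lra.
      rewrite (_ : (s * th) ^+ 3 = (s ^+ 2 * th) * (s * th ^+ 2)); last by ring.
      by rewrite ler_piMr// expr2; nra.
    move=> hh.
    have z3 : 0 <= N z ^+ 3 by rewrite exprn_ge0.
    have x3' : N x ^+ 3 <= q ^+ k * th ^+ k * N z ^+ 3.
      by rewrite (le_trans x3)// ler_wpM2r.
    have : q * C1 * N x ^+ 3 <= q * C1 * (q ^+ k * th ^+ k * N z ^+ 3).
      by rewrite ler_wpM2l// mulr_ge0// ltW.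
    by lra.
  have -> : lam ^- k.+1 * P (f1C lam x) - P z =
    lam ^- k.+1 * (P (f1C lam x) - lam * P x) + (lam ^- k * P x - P z).
    by rewrite exprSr; field; rewrite lam0 expf_neq0.
  apply: (le_trans (modulusD_le _ _ _)).
  apply: (le_trans (lerD step IH)).
  rewrite -mulrDl ler_wpM2r ?exprn_ge0//.
  have t1 : 1 - th != 0 by rewrite gt_eqF//; lra.
  rewrite (_ : C1 / (1 - th) * (1 - th ^+ k.+1) = C1 * th ^+ k + C1 / (1 - th) * (1 - th ^+ k))//.
  by rewrite (exprS th k); field.
set x := iter n _ z.
have xN := iterN n; rewrite -/x in xN.
(* Replacing P x by x costs b lam^(-n) x^2, which dies out because (s th)^2 <= q th. *)
have -> : lam ^- n * x - (z + b * z ^+ 2) =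
   (lam ^- n * P x - P z) - b * (lam ^- n * x ^+ 2) by rewrite /P; ring.
apply: (le_trans (modulusB_le _ _ _)); apply: lerD.
  apply: (le_trans (main n)); rewrite ler_wpM2r ?exprn_ge0//.
  rewrite ler_piMr//; first by rewrite divr_ge0//; lra.
  by rewrite lerBlDr lerDl exprn_ge0// ltW.
rewrite !modulusM -mulrA ler_wpM2l ?modulus_ge0//.
rewrite modulusV !modulusX -/q ler_pdivrMl ?exprn_gt0//.
have x2 : N x ^+ 2 <= (s * th) ^+ n ^+ 2 * N z ^+ 2.
  rewrite -exprMn ler_pXn2r ?nnegrE ?modulus_ge0//.
  by rewrite mulr_ge0// exprn_ge0//; lra.
apply: (le_trans x2); rewrite [leRHS]mulrA ler_wpM2r ?exprn_ge0//.
rewrite -exprMn -exprM mulnC exprM; apply: lerXn2r; rewrite ?nnegrE ?exprn_ge0//; try lra.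
  by rewrite mulr_ge0// ltW.
rewrite exprMn s2 ler_wpM2l ?(ltW q0)//.
by rewrite expr2; nra.
Qed.

(** For fixed z != 0 the transient term in th^n eventually drops below |z|^3; the threshold [n0]
    depends on z, the constants do not. *)
Lemma koenigs_est : exists r C : R,
  [/\ 0 < r <= 2^-1, 0 <= C &
   forall z, z != 0 -> N z <= r ->
     (forall n, N (iter n (f1C lam) z) <= N z) /\
     exists n0, forall n, (n0 <= n)%N ->
     N (lam ^- n * iter n (f1C lam) z - (z + b * z ^+ 2)) <= C * N z ^+ 3].
Proof.
have [th [r [C [/andP[th0 th1] hr C0 H]]]] := koenigs_iter.
exists r, (C + 1); split => //; first by lra.
move=> z z0 zr; split => [n|]; first by have [] := H z zr n.
have zp : 0 < N z by rewrite modulus_gt0.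
have b0 := modulus_ge0 _ b.
have [|||n0 Hn0] := @expr_lt_eps _ th (N z / (N b + 1)).
- exact: ltW.
- exact: th1.
- by rewrite divr_gt0//; lra.
exists n0 => n /Hn0 hn; have [_ /le_trans] := H z zr n; apply.
rewrite mulrDl mul1r lerD2l (exprS (N z) 2) ler_wpM2r ?exprn_ge0 ?(ltW zp)//.
move: hn; rewrite ltr_pdivlMr; last by lra.
have : 0 <= th ^+ n by rewrite exprn_ge0// ltW.
nra.
Qed.

End Koenigs.

(** * Recurrence and nearest points *)

Section Recurrence.
Variable R : realType.
Implicit Types (x y z : R[i]).

Lemma exists_pow2_mul_ge1 (q : R) n : 0 < q -> q < 1 ->
  exists m, 1 <= 2 ^+ m * q ^+ n < 2.
Proof.
move=> q0 q1.
have qn : 0 < q ^+ n by rewrite exprn_gt0.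
have [m0 H] := @exists_expn2_gt R (q ^+ n)^-1.
have ex : exists m, 1 <= 2 ^+ m * q ^+ n.
  exists m0; rewrite -[leLHS](mulVf (lt0r_neq0 qn)) ler_pM2r//.
  exact/ltW/H.
case: (ex_minnP ex) => m hm hmin; exists m; rewrite hm /=.
case: m => [|m] in hm hmin *.
  have : q ^+ n <= 1 by apply: exprn_ile1; exact: ltW.
  by rewrite expr0 mul1r; lra.
rewrite exprS -mulrA -[ltRHS]mulr1 ltr_pM2l// ltNge.
by apply/negP => /hmin; rewrite ltnn.
Qed.

(** Choosing m as a function of n keeps 2^m lam^n in the annulus 1 <= |u| < 2. Two such points that
    are close to each other have a quotient close to 1, and that quotient is again of the form 2^m
    lam^n. *)
Lemma pow2_mul_expr_recurrence (lam : R[i]) (eps : R) M : lam != 0 -> N lam < 1 -> 0 < eps ->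
  exists m n, [/\ (M <= m)%N, (M <= n)%N & N (2 ^+ m * lam ^+ n - 1) < eps].
Proof.
move=> l0 l1 e0; have q0 : 0 < N lam by rewrite modulus_gt0.
have [f Hf] := choice (fun n => exists_pow2_mul_ge1 _ n q0 l1).
pose u n : R[i] := 2 ^+ f n * lam ^+ n.
have uN n : N (u n) = 2 ^+ f n * N lam ^+ n by rewrite modulusM !modulusX modulus_nat.
have [n|s Hs] := @bounded_seq_cluster R u 2.
  by rewrite uN ltW//; have /andP[] := Hf n.
have e20 : 0 < eps / 2 by lra.
(* An index gap of at least K shrinks |lam|^n so much that the exponent of 2 has to grow by more
   than M to stay in the annulus. *)
have [K HK] := expr_lt_eps _ (N lam) (2 ^+ M.+1)^-1 (ltW q0) l1 ltac:(by rewrite invr_gt0 exprn_gt0).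
have [n1 _ H1] := Hs _ 0%N e20.
have [n2 n12 H2] := Hs _ (n1 + (M + K))%N e20.
pose n := (n2 - n1)%N.
have n2E : n2 = (n1 + n)%N by rewrite /n subnKC// (leq_trans (leq_addr _ _) n12).
have nMK : (M + K <= n)%N by rewrite n2E leq_add2l in n12.
have qn : 2 ^+ M.+1 * N lam ^+ n < 1.
  by rewrite -ltr_pdivlMl ?exprn_gt0// mulr1 HK// (leq_trans _ nMK)// leq_addl.
have /andP[a1 a2] := Hf n1; have /andP[b1 b2] := Hf n2.
have lt : (f n1 + M < f n2)%N.
  rewrite -(@ltr_eXn2l R 2)// ?ltr1n// -(ltr_pM2r (exprn_gt0 n2 q0)).
  apply: lt_le_trans b1; apply: le_lt_trans qn.
  rewrite n2E !exprD exprS.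
  have h0 : 0 <= 2 ^+ M * N lam ^+ n by rewrite mulr_ge0// exprn_ge0// ltW.
  have : (2 ^+ f n1 * N lam ^+ n1) * (2 ^+ M * N lam ^+ n) <= 2 * (2 ^+ M * N lam ^+ n).
    by rewrite ler_wpM2r// ltW.
  by lra.
pose m := (f n2 - f n1)%N.
have mE : f n2 = (f n1 + m)%N by rewrite /m subnKC// ltnW// (leq_ltn_trans _ lt)// leq_addr.
exists m, n; split.
- by rewrite mE ltn_add2l in lt; exact: ltnW.
- by rewrite (leq_trans _ nMK)// leq_addr.
have : N (u n2 - u n1) < eps.
  have := modulus_tri _ s (u n2) (u n1); rewrite (modulusBC _ s); lra.
rewrite (_ : _ - _ = u n1 * (2 ^+ m * lam ^+ n - 1)); last first.
  by rewrite /u mE n2E !exprD; ring.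
rewrite modulusM; apply: le_lt_trans.
by rewrite uN -[leLHS]mul1r ler_wpM2r// modulus_ge0.
Qed.

(** The same recurrence on the unit circle. The bound 2 <= n guarantees that the sum of mu^j for j <
    n contains both 1 and mu. *)
Lemma unit_expr_recurrence (mu : R[i]) (eps : R) : N mu = 1 -> 0 < eps ->
  exists2 n, (2 <= n)%N & N (mu ^+ n - 1) < eps.
Proof.
move=> mu1 e0.
have [n|s Hs] := @bounded_seq_cluster R (fun n => mu ^+ n) 1.
  by rewrite modulusX mu1 expr1n.
have e20 : 0 < eps / 2 by lra.
have [n1 _ H1] := Hs _ 0%N e20.
have [n2 n12 H2] := Hs _ (n1 + 2)%N e20.
have n2E : n2 = (n1 + (n2 - n1))%N by rewrite subnKC// (leq_trans (leq_addr _ _) n12).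
exists (n2 - n1)%N; first by rewrite -(leq_add2l n1) -n2E.
have : N (mu ^+ n2 - mu ^+ n1) < eps.
  have := modulus_tri _ s (mu ^+ n2) (mu ^+ n1); rewrite (modulusBC _ s); lra.
rewrite {1}n2E exprD (_ : _ - _ = mu ^+ n1 * (mu ^+ (n2 - n1) - 1)); last by ring.
by rewrite modulusM modulusX mu1 expr1n mul1r.
Qed.

(** Let mu = lam / |lam|. If all Re (a mu^j) were nonpositive, the geometric sums a (mu^n - 1) / (mu
    - 1), which are small whenever mu^n is near 1, would force Re a = Re (a mu) = 0. Then a = 0 or
    lam is real. *)
Lemma exists_Re_mul_expr_gt0 (lam a : R[i]) : complex.Im lam != 0 -> a != 0 ->
  exists j, 0 < complex.Re (a * lam ^+ j).
Proof.
move=> iml a0; apply: contrapT => /forallNP H.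
have l0 : lam != 0 by apply: contraNneq iml => ->.
have q0 : 0 < N lam by rewrite modulus_gt0.
have qC : (N lam)%:C != 0 :> R[i].
  by apply/eqP => /(congr1 (@complex.Re R)) /= /eqP; rewrite gt_eqF.
pose mu := lam / (N lam)%:C.
have lE : lam = (N lam)%:C * mu by rewrite /mu mulrC divfK.
clearbody mu.
have Hmu j : complex.Re (a * mu ^+ j) <= 0.
  rewrite leNgt; apply/negP => h; apply: (H j).
  rewrite lE exprMn -rmorphXn/= mulrCA.
  move: h; case: (a * _) => c d /= h.
  by rewrite mul0r subr0 mulr_gt0// exprn_gt0.
have mu1 : N mu = 1.
  apply: (mulfI (lt0r_neq0 q0)); rewrite mulr1 [in RHS]lE modulusM; congr (_ * _).
  by rewrite /modulus /= expr0n addr0 sqrtr_sqr ger0_norm// ltW.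
have muN1 : mu - 1 != 0.
  rewrite subr_eq0; apply/eqP => m1; move: iml; rewrite lE m1 mulr1.
  by rewrite /= eqxx.
have key i : (i < 2)%N -> 0 <= complex.Re (a * mu ^+ i).
  move=> i2; apply/ler_addgt0Pr => eps e0.
  have d0 : 0 < N (mu - 1) by rewrite modulus_gt0.
  have a00 : 0 < N a by rewrite modulus_gt0.
  have [n n2 Hn] := unit_expr_recurrence _ (eps * N (mu - 1) / N a) mu1 ltac:(by rewrite divr_gt0// mulr_gt0).
  have S : complex.Re (a * \sum_(j < n) mu ^+ j) <= complex.Re (a * mu ^+ i).
    rewrite mulr_sumr raddf_sum/= (bigD1 (Ordinal (leq_trans i2 n2)))//=.
    by rewrite gerDl sumr_le0.
  have : N (a * \sum_(j < n) mu ^+ j) < eps.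
    rewrite -(ltr_pM2r d0) -modulusM -mulrA [_ * (mu - 1)]mulrC -subrX1 modulusM.
    by rewrite mulrC -ltr_pdivlMr.
  have := Re_le_modulus _ (a * \sum_(j < n) mu ^+ j).
  rewrite ler_norml => /andP[]; lra.
have h0 := key 0%N isT; have g0 := Hmu 0%N; rewrite expr0 mulr1 in h0 g0.
have h1 := key 1%N isT; have g1 := Hmu 1%N; rewrite expr1 in h1 g1.
have e0 : complex.Re a = 0 by apply/eqP; rewrite eq_le g0.
have e1 : complex.Re (a * mu) = 0 by apply/eqP; rewrite eq_le g1.
have : complex.Re (a * lam) = 0.
  rewrite lE mulrCA; move: e1; case: (a * mu) => c d /= ->; ring.
move: a0 e0 iml; case: a {H Hmu key h0 g0 h1 g1 e1} => c d /=.
case: lam {l0 q0 qC mu lE mu1 muN1} => e f /= a0 c0 f0.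
rewrite c0 mul0r sub0r => /eqP; rewrite oppr_eq0 mulf_eq0 (negbTE f0) orbF => /eqP d0.
by move: a0; rewrite c0 d0 eqxx.
Qed.

(** A minimizing sequence is bounded, and its cluster point lies in the closed set T. *)
Lemma exists_nearest (T : R[i] -> Prop) (t0 p : R[i]) :
  (forall s, (forall eps, 0 < eps -> exists2 t, T t & N (t - s) < eps) -> T s) ->
  T t0 -> exists2 s, T s & forall t, T t -> N (p - s) <= N (p - t).
Proof.
move=> Tcl T0.
pose D := [set N (p - t) | t in [set t | T t]].
have hi : has_inf D.
  split; first by exists (N (p - t0)), t0.
  by exists 0 => _ [t _ <-]; exact: modulus_ge0.
have Dlb t : T t -> inf D <= N (p - t).
  by move=> Tt; apply: (ge_inf hi.2); exists t.
have H n : exists t, T t /\ N (p - t) < inf D + n.+1%:R^-1.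
  have n0 : 0 < n.+1%:R^-1 :> R by rewrite invr_gt0.
  have [_ [t Tt <-] h] := inf_adherent n0 hi.
  by exists t.
have [u Hu] := choice H.
have [n|s Hs] := @bounded_seq_cluster R u (inf D + 1 + N p).
  have [_ h] := Hu n.
  have e1 : n.+1%:R^-1 <= 1 :> R by rewrite invf_le1// ler1n.
  have := modulus_tri _ p (u n) 0; rewrite !subr0 (modulusBC _ (u n)).
  move: h e1; set e := _.+1%:R^-1 => h e1; lra.
exists s.
  apply: Tcl => eps e0; have [n _ h] := Hs _ 0%N e0.
  by exists (u n) => //; have [] := Hu n.
move=> t Tt; apply: (le_trans _ (Dlb _ Tt)); apply/ler_addgt0Pr => eps e0.
have e20 : 0 < eps / 2 by lra.
have [M HM] := @exists_expn2_gt R (eps / 2)^-1.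
have [n Mn h] := Hs _ (2 ^ M)%N e20.
have [_ h2] := Hu n.
have h3 : n.+1%:R^-1 < eps / 2.
  rewrite invf_plt ?posrE// (lt_le_trans (HM M (leqnn _)))//.
  by rewrite -natrX ler_nat (leq_trans Mn).
have := modulus_tri _ (u n) p s.
move: h2 h3; set e := _.+1%:R^-1 => h2 h3; lra.
Qed.

Lemma modulusB_scale_sqr (v d : R[i]) (e : R) :
  N (v - e%:C * d) ^+ 2 = N v ^+ 2 - 2 * e * complex.Re (d * v^*) + e ^+ 2 * N d ^+ 2.
Proof.
rewrite !modulus_sqr; case: v => a b; case: d => c f /=; ring.
Qed.

Lemma pow2V_C k : ((2 ^- k : R)%:C = 2 ^- k :> R[i]).
Proof. by rewrite fmorphV rmorphXn/= rmorph_nat. Qed.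

Lemma descent (v d : R[i]) (K : R) : 0 < complex.Re (d * v^*) -> 0 <= K ->
  exists k0, forall k, (k0 <= k)%N ->
    N (v - 2 ^- k * d) + K * (2 ^- k) ^+ 2 < N v.
Proof.
move=> k0 K0.
have v0 : 0 < N v.
  rewrite modulus_gt0; apply: contraTneq k0 => ->.
  by case: d => c f /=; rewrite oppr0 !mulr0 subr0 ltxx.
set kap := complex.Re _ in k0.
(* For 2^-k < 1/B, the first summand makes the linear gain exceed the quadratic terms; the second
   keeps |v| - K 4^-k positive, so that both sides can be squared. *)
pose B := (N d ^+ 2 + 2 * K * N v) / (2 * kap) + (K + N v) / N v.
have [M HM] := @exists_expn2_gt R B.
exists M => k /HM hB; set e : R := 2 ^- k.
have e0 : 0 < e by rewrite invr_gt0 exprn_gt0.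
have eB : e * B < 1.
  by rewrite mulrC ltr_pdivrMr ?exprn_gt0// mul1r.
have B1 : 0 <= (N d ^+ 2 + 2 * K * N v) / (2 * kap).
  by rewrite divr_ge0// ?addr_ge0 ?mulr_ge0 ?exprn_ge0 ?modulus_ge0//; lra.
have B2 : 0 <= (K + N v) / N v by rewrite divr_ge0//; lra.
have e1 : e * (N d ^+ 2 + 2 * K * N v) < 2 * kap.
  rewrite -[ltRHS]mul1r -ltr_pdivrMr; last by lra.
  by rewrite -[ltLHS]mulrA; apply: le_lt_trans eB; rewrite ler_wpM2l ?(ltW e0)// /B; lra.
have e2 : e * (K + N v) < N v.
  rewrite -[ltRHS]mul1r -ltr_pdivrMr//.
  by rewrite -[ltLHS]mulrA; apply: le_lt_trans eB; rewrite ler_wpM2l ?(ltW e0)// /B; lra.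
have e3 : e < 1.
  have : 0 <= e * K by rewrite mulr_ge0// ltW.
  by move=> ?; rewrite -(ltr_pM2r v0) mul1r; lra.
rewrite -ltrBrDr -pow2V_C -/e.
have Ke : K * e ^+ 2 <= e * K.
  by rewrite expr2 mulrA [K * e]mulrC ler_piMr ?mulr_ge0// ltW.
have ev : 0 < e * N v by rewrite mulr_gt0.
rewrite -(@ltr_pXn2r _ 2)// ?nnegrE ?modulus_ge0//; last by lra.
rewrite modulusB_scale_sqr -/kap.
have : e * (e * (N d ^+ 2 + 2 * K * N v)) < e * (2 * kap) by rewrite ltr_pM2l.
have := sqr_ge0 (K * e ^+ 2).
rewrite !expr2; lra.
Qed.

End Recurrence.

(** * The blow-up of the orbit at 0 *)

Section Blowup.
Variable R : realType.
Implicit Types (y z s t : R[i]).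
Variables (lam : R[i]) (A : R[i] -> Prop).
Hypothesis lam0 : lam != 0.
Hypothesis lam1 : N lam < 1.
Hypothesis Af : forall y, A y -> A (f0C y).
Hypothesis Ag : forall y, A y -> y != -1 -> A (f1C lam y).

(** The set T of the opening remark. Asking for m >= M with M arbitrary forces y to 0 and makes
    division by 2 possible. *)
Definition blowup t := forall (eps : R) M, 0 < eps ->
  exists m y, [/\ (M <= m)%N, A y & N (2 ^+ m * y - t) < eps].

Lemma blowup_small t : blowup t -> forall (eps : R) M, 0 < eps ->
  exists m y, [/\ (M <= m)%N, A y, N (2 ^+ m * y - t) < eps & N y < eps].
Proof.
move=> Tt eps M e0.
have [M2 HM] := @exists_expn2_gt R ((N t + eps) / eps).
have [m [y [Mm Ay h]]] := Tt eps (M + M2)%N e0.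
exists m, y; split => //; first by rewrite (leq_trans _ Mm)// leq_addr.
have m2 := HM m (leq_trans (leq_addl _ _) Mm).
rewrite ltr_pdivrMr// in m2.
have : N (2 ^+ m * y) <= N t + eps.
  by have := modulus_tri _ t (2 ^+ m * y) 0; rewrite !subr0; lra.
rewrite modulusM modulusX modulus_nat => h2.
by rewrite -(ltr_pM2l (exprn_gt0 m (ltr0Sn R 1))); lra.
Qed.

Lemma blowup_closed s :
  (forall eps, 0 < eps -> exists2 t, blowup t & N (t - s) < eps) -> blowup s.
Proof.
move=> H eps M e0; have e20 : 0 < eps / 2 by lra.
have [t Tt h] := H _ e20; have [m [y [Mm Ay h2]]] := Tt _ M e20.
exists m, y; split => //.
have := modulus_tri _ t (2 ^+ m * y) s; lra.
Qed.

Lemma blowup_mul2 t : blowup t -> blowup (2 * t).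
Proof.
move=> Tt eps M e0; have e20 : 0 < eps / 2 by lra.
have [m [y [Mm Ay h]]] := Tt _ M e20; exists m.+1, y; split => //.
  exact: leqW.
rewrite (_ : _ - _ = 2 * (2 ^+ m * y - t)); last by rewrite exprS; ring.
by rewrite modulusM modulus_nat; lra.
Qed.

Lemma blowup_div2 t : blowup t -> blowup (t / 2).
Proof.
move=> Tt eps M e0; have [m [y [Mm Ay h]]] := Tt _ M.+1 e0.
case: m => // m in Mm h *; exists m, y; split => //.
rewrite (_ : _ - _ = (2 ^+ m.+1 * y - t) / 2); last by rewrite exprS; field.
rewrite modulusM modulusV modulus_nat; have := modulus_ge0 _ (2 ^+ m.+1 * y - t); lra.
Qed.

Lemma blowup_pow2 k t : blowup t -> blowup (2 ^+ k * t).
Proof.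
by move=> Tt; elim: k => [|k IH]; rewrite ?mul1r// exprS -mulrA; exact: blowup_mul2.
Qed.

Lemma blowup_pow2V k t : blowup t -> blowup (2 ^- k * t).
Proof.
move=> Tt; elim: k => [|k IH]; first by rewrite expr0 invr1 mul1r.
rewrite exprS invfM -mulrA mulrC; exact: blowup_div2.
Qed.

(** Since f_1(y) = lam y + O(y^2), multiplying by 2^m leaves an error of order |2^m y| |y|, which
    vanishes as y tends to 0. *)
Lemma blowup_lam t : blowup t -> blowup (lam * t).
Proof.
move=> Tt eps M e0; have t0 := modulus_ge0 _ t.
pose d := Num.min (eps / 2) (Num.min 2^-1 (eps / (20 * (N t + 1)))).
have d0 : 0 < d by rewrite !lt_min; apply/and3P; split; [lra|lra|rewrite divr_gt0//; lra].
have [m [y [Mm Ay h hy]]] := blowup_small _ Tt _ M d0.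
move: h hy; rewrite !lt_min => /and3P[h1 h2 h3] /and3P[h4 h5 h6].
have yN1 : y != -1.
  by apply: contraTneq h5 => ->; rewrite modulusN modulus1 -leNgt; lra.
exists m, (f1C lam y); split => //; first exact: Ag.
have y0 := modulus_ge0 _ y; have l0 := modulus_ge0 _ lam.
rewrite (_ : _ - _ = 2 ^+ m * (f1C lam y - lam * (y - 2 * y ^+ 2))
   + lam * ((2 ^+ m * y - t) - 2 * (2 ^+ m * y) * y)); last by ring.
have E := f1C_est _ lam y (ltW h5).
have Y : N (2 ^+ m * y) <= N t + 1.
  by have := modulus_tri _ t (2 ^+ m * y) 0; rewrite !subr0; lra.
have n1 : N (2 ^+ m * (f1C lam y - lam * (y - 2 * y ^+ 2))) <= 8 * (N (2 ^+ m * y) * N y).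
  rewrite !(modulusM _ (2 ^+ m)) modulusX modulus_nat.
  have p0 : 0 <= 2 ^+ m :> R by rewrite exprn_ge0.
  rewrite [leRHS]mulrCA -mulrA ler_wpM2l//.
  apply: (le_trans E); have y2 : 0 <= N y * N y by rewrite mulr_ge0.
  have : N lam * (N y * (N y * N y)) <= 1 * (2^-1 * (N y * N y)).
    by apply: ler_pM => //; rewrite ?mulr_ge0 ?ler_wpM2r// ltW.
  by rewrite !exprS expr0; lra.
have n2 : N (lam * ((2 ^+ m * y - t) - 2 * (2 ^+ m * y) * y)) <= N (2 ^+ m * y - t) + 2 * (N (2 ^+ m * y) * N y).
  rewrite modulusM -[leRHS]mul1r; apply: ler_pM; rewrite ?modulus_ge0 ?(ltW lam1)//.
  apply: (le_trans (modulusB_le _ _ _)).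
  by rewrite lerD2l (modulusM _ _ y) (modulusM _ 2) modulus_nat mulrA.
apply: (le_lt_trans (modulusD_le _ _ _)); apply: (le_lt_trans (lerD n1 n2)).
have : N (2 ^+ m * y) * N y <= (N t + 1) * N y by rewrite ler_wpM2r.
move: h6; rewrite ltr_pdivlMr; last by lra.
by lra.
Qed.

Lemma blowup_lamX n t : blowup t -> blowup (lam ^+ n * t).
Proof.
by move=> Tt; elim: n => [|n IH]; rewrite ?mul1r// exprS -mulrA; exact: blowup_lam.
Qed.

(** When 2^m lam^n is close to 1 and n >= j, the point 2^m lam^(n - j) t approximates lam^(-j) t. *)
Lemma blowup_lamVX j t : blowup t -> blowup (lam ^- j * t).
Proof.
move=> Tt; apply: blowup_closed => eps e0.
have c0 : 0 < N (lam ^- j * t) + 1 by have := modulus_ge0 _ (lam ^- j * t); lra.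
have [m [n [_ jn h]]] := pow2_mul_expr_recurrence _ _ (eps / (N (lam ^- j * t) + 1)) j lam0 lam1 ltac:(by rewrite divr_gt0).
exists (2 ^+ m * (lam ^+ (n - j) * t)); first exact/blowup_pow2/blowup_lamX.
rewrite (_ : _ - _ = (2 ^+ m * lam ^+ n - 1) * (lam ^- j * t)); last first.
  rewrite -{2}(subnK jn) exprD; field; exact: expf_neq0.
move: h; rewrite modulusM ltr_pdivlMr//.
have := modulus_ge0 _ (2 ^+ m * lam ^+ n - 1); lra.
Qed.

Local Notation b := (kcoef R lam).

(** Here f_1^n(y) is about lam^n times the linearization of f_1 at y. Along returns of 2^m lam^n to
    1, the points 2^m f_1^n(y) are bounded, and any cluster point belongs to the blow-up. *)
Lemma blowup_of_point : exists r C : R, [/\ 0 < r <= 2^-1, 0 <= C &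
  forall y, A y -> y != 0 -> N y <= r ->
    exists2 s, blowup s & N (s - (y + b * y ^+ 2)) <= C * N y ^+ 3].
Proof.
have [r [C [hr C0 H]]] := koenigs_est _ lam lam0 lam1.
exists r, C; split => // y Ay y0 yr.
have [itN [n0 Hn0]] := H y y0 yr.
have Ait n : A (iter n (f1C lam) y).
  elim: n => //= n IH; apply: Ag => //.
  have h : N (iter n (f1C lam) y) < 1 by have := itN n; lra.
  by apply: contraTneq h => ->; rewrite modulusN modulus1 ltxx.
set P := y + _ in Hn0 *.
(* The summand k sends the exponent of 2 to infinity; [n0] makes the estimate on the iterates of f_1
   available. *)
have rec k : exists mn : nat * nat, [/\ (k + n0 <= mn.1)%N, (k + n0 <= mn.2)%N &
    N (2 ^+ mn.1 * lam ^+ mn.2 - 1) < k.+1%:R^-1].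
  have [m [n [h1 h2 h3]]] := pow2_mul_expr_recurrence _ _ (k.+1%:R^-1) (k + n0)%N lam0 lam1 ltac:(by rewrite invr_gt0).
  by exists (m, n).
have [u Hu] := choice rec.
pose L k := lam ^- (u k).2 * iter (u k).2 (f1C lam) y.
pose x k := 2 ^+ (u k).1 * iter (u k).2 (f1C lam) y.
have LP k : N (L k - P) <= C * N y ^+ 3.
  apply: Hn0; have [_ h _] := Hu k; exact: leq_trans (leq_addl _ _) h.
pose B := N P + C * N y ^+ 3.
have LB k : N (L k) <= B.
  by have := modulus_tri _ P (L k) 0; rewrite !subr0 /B; have := LP k; lra.
have B0 : 0 <= B by exact: le_trans (modulus_ge0 _ _) (LB 0%N).
have xL k : N (x k - L k) <= k.+1%:R^-1 * B.
  rewrite (_ : _ - _ = (2 ^+ (u k).1 * lam ^+ (u k).2 - 1) * L k); last first.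
    rewrite /x /L; field; exact: expf_neq0.
  rewrite modulusM; apply: ler_pM; rewrite ?modulus_ge0//.
  by have [_ _ /ltW] := Hu k.
have [k|s Hs] := @bounded_seq_cluster R x (B + B).
  rewrite -(subrK (L k) (x k)); apply: (le_trans (modulusD_le _ _ _)).
  apply: lerD => //; apply: (le_trans (xL k)).
  by rewrite ler_piMl// invf_le1// ler1n.
exists s => [eps M e0|].
  have [k Mk h] := Hs eps M e0.
  exists (u k).1, (iter (u k).2 (f1C lam) y); split => //.
  have [h1 _ _] := Hu k; exact: leq_trans (leq_trans Mk (leq_addr _ _)) h1.
apply/ler_addgt0Pr => eps e0.
have e20 : 0 < eps / 2 by lra.
have [M HM] := @exists_expn2_gt R (B / (eps / 2)).
have [k Mk h] := Hs (eps / 2) (2 ^ M)%N e20.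
have h2 : k.+1%:R^-1 * B < eps / 2.
  rewrite mulrC ltr_pdivrMr// -ltr_pdivrMl// mulrC.
  apply: (lt_le_trans (HM M (leqnn _))).
  by rewrite -natrX ler_nat (leq_trans Mk).
have := modulus_tri _ (x k) s P; have := modulus_tri _ (L k) (x k) P.
have := LP k; have := le_lt_trans (xL k) h2; rewrite (modulusBC _ s (x k)); lra.
Qed.

(* The coefficient c of the header: 1/2 comes from exp, the inverse of the
   linearization log(1 + z) of f_0, and b from the linearization of f_1. *)
Definition tcoef : R[i] := 2^-1 + b.

(** The coefficient equals -(3 + lam) / (2 (1 - lam)), which vanishes only at lam = -3. *)
Lemma tcoef_neq0 : tcoef != 0.
Proof.
have l1 := lam_neq1 _ lam lam1.
rewrite (_ : tcoef = - ((3 + lam) / (2 * (1 - lam)))); last first.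
  by rewrite /tcoef /kcoef; field.
rewrite oppr_eq0 mulf_neq0 ?invr_neq0 ?mulf_neq0//.
by rewrite -modulus_gt0 (lt_le_trans _ (modulusD_ge _ 3 lam))// modulus_nat subr_gt0 (lt_le_trans lam1)// ler1n.
Qed.

(** If 2^m y is close to t, the orbit point f_0^m(y) is about exp(t) - 1 = t + t^2/2 + O(t^3).
    Feeding it to [blowup_of_point] adds b t^2. *)
Lemma blowup_step : exists r C : R, [/\ 0 < r, 0 <= C &
  forall t, blowup t -> t != 0 -> N t <= r ->
    exists2 s, blowup s & N (s - t - tcoef * t ^+ 2) <= C * N t ^+ 3].
Proof.
have [r [C [/andP[r0 r2] C0 H]]] := blowup_of_point.
have b0 := modulus_ge0 _ b.
(* The orbit point y0 built below satisfies |y0| <= 2 |t| <= r, whence 8 C; 12 bounds the error in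
   its expansion, and 3 |b| the replacement of y0^2 by t^2. *)
exists (Num.min (r / 2) 24^-1), (8 * C + 12 + 3 * N b); split.
- by rewrite lt_min; apply/andP; split; lra.
- by lra.
move=> t Tt t0; rewrite le_min => /andP[tr t24].
have tp : 0 < N t by rewrite modulus_gt0.
pose e := N t ^+ 3; have e0 : 0 < e by rewrite exprn_gt0.
have [m [y [_ Ay h hy]]] := blowup_small _ Tt _ 0%N e0.
pose Y := 2 ^+ m * y.
rewrite -/Y in h.
have t2 : N t ^+ 2 <= N t / 24 by rewrite expr2 ler_wpM2l// ltW.
have t2p : 0 <= N t ^+ 2 by rewrite exprn_ge0 ?modulus_ge0.
have t3 : e <= N t ^+ 2 / 24 by rewrite /e exprSr ler_wpM2l.
have Yt : N Y <= 2 * N t.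
  by have := modulus_tri _ t Y 0; rewrite !subr0; lra.
have YE : N Y = (2 ^ m)%:R * N y by rewrite /Y modulusM modulusX modulus_nat natrX.
have Y0 := modulus_ge0 _ Y.
have hY : (2 ^ m)%:R * N y <= 2^-1 by rewrite -YE; lra.
have := expD1_est3 _ y (2 ^ m) hY.
rewrite -YE natrX -/Y -iter_f0CE; set y0 := iter m _ y => E.
clearbody Y.
have E1 : N (y0 - t - t ^+ 2 / 2) <= 12 * e.
  rewrite (_ : _ - _ = (y0 - Y - Y * (Y - y) / 2) +
     ((Y - t) + ((Y - t) * (Y + t) - Y * y) * 2^-1)); last by field.
  have n1 : N Y ^+ 3 <= 8 * e.
    rewrite /e (_ : 8 * _ = (2 * N t) ^+ 3); last by ring.
    by rewrite ler_pXn2r ?nnegrE// mulr_ge0// ltW.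
  have n2 : N ((Y - t) * (Y + t) - Y * y) <= 2 * e.
    apply: (le_trans (modulusB_le _ _ _)); rewrite !modulusM.
    have : N (Y - t) * N (Y + t) <= e * 1.
      apply: ler_pM; rewrite ?modulus_ge0 ?(ltW h)//.
      by apply: (le_trans (modulusD_le _ _ _)); lra.
    have : N Y * N y <= 1 * e.
      by apply: ler_pM; rewrite ?modulus_ge0 ?(ltW hy)//; lra.
    lra.
  apply: (le_trans (modulusD_le _ _ _)).
  have := modulusD_le _ (Y - t) (((Y - t) * (Y + t) - Y * y) * 2^-1).
  by rewrite (modulusM _ _ 2^-1) modulusV modulus_nat; lra.
have E2 : N (y0 - t) <= N t ^+ 2.
  have := modulusD_le _ (y0 - t - t ^+ 2 / 2) (t ^+ 2 / 2); rewrite subrK.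
  by rewrite (modulusM _ _ 2^-1) modulusV modulus_nat modulusX; lra.
have y0t : N y0 <= 2 * N t.
  by have := modulus_tri _ t y0 0; rewrite !subr0; lra.
have y00 : y0 != 0.
  by rewrite -modulus_gt0; have := modulus_tri _ y0 t 0; rewrite !subr0 (modulusBC _ t); lra.
have Ay0 : A y0 by rewrite /y0; elim: (m) => //= k; exact: Af.
have [s Ts hs] := H y0 Ay0 y00 ltac:(lra).
exists s => //.
rewrite (_ : _ - _ = (s - (y0 + b * y0 ^+ 2)) + ((y0 - t - t ^+ 2 / 2)
   + b * ((y0 - t) * (y0 + t)))); last by rewrite /tcoef; field.
have n1 : C * N y0 ^+ 3 <= 8 * C * e.
  rewrite (_ : 8 * C * e = C * (2 * N t) ^+ 3); last by rewrite /e; ring.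
  by rewrite ler_wpM2l// ler_pXn2r ?nnegrE ?modulus_ge0// mulr_ge0// ltW.
have n2 : N (b * ((y0 - t) * (y0 + t))) <= N b * (3 * e).
  rewrite modulusM ler_wpM2l// modulusM /e (_ : 3 * _ = N t ^+ 2 * (3 * N t)); last by ring.
  apply: ler_pM; rewrite ?modulus_ge0//.
  by apply: (le_trans (modulusD_le _ _ _)); lra.
apply: (le_trans (modulusD_le _ _ _)).
have := modulusD_le _ (y0 - t - t ^+ 2 / 2) (b * ((y0 - t) * (y0 + t))).
rewrite -/e; lra.
Qed.

Hypothesis lamIm : complex.Im lam != 0.
Hypothesis Asmall : forall eps : R, 0 < eps -> exists y, [/\ A y, y != 0 & N y < eps].

(** At a sufficiently small orbit point y != 0, the terms of order two and three in
    [blowup_of_point] cannot cancel y. *)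
Lemma blowup_nontrivial : exists2 t, blowup t & t != 0.
Proof.
have [r [C [/andP[r0 r2] C0 H]]] := blowup_of_point.
have b0 := modulus_ge0 _ b.
pose d := Num.min r (2 * (1 + C + N b))^-1.
have d0 : 0 < d by rewrite lt_min r0 invr_gt0; lra.
have [y [Ay y0]] := Asmall _ d0; rewrite lt_min => /andP[yr yC].
have [s Ts hs] := H y Ay y0 (ltW yr).
exists s => //; rewrite -modulus_gt0.
have yp : 0 < N y by rewrite modulus_gt0.
have y2p : 0 <= N y ^+ 2 by rewrite exprn_ge0 ?modulus_ge0.
have y2 : N y ^+ 2 <= N y / (2 * (1 + C + N b)) by rewrite expr2 ler_wpM2l// ltW.
have y3 : N y ^+ 3 <= N y ^+ 2 by rewrite exprSr ler_piMr//; lra.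
have h1 : (C + N b) * N y ^+ 2 <= N y / 2.
  apply: (@le_trans _ _ ((1 + C + N b) * N y ^+ 2)).
    by rewrite ler_wpM2r//; lra.
  move: y2; rewrite ler_pdivlMr; last by lra.
  by lra.
have h2 : C * N y ^+ 3 <= C * N y ^+ 2 by rewrite ler_wpM2l.
have := modulus_tri _ s y (- (b * y ^+ 2)); rewrite opprK.
have := modulusD_ge _ y (b * y ^+ 2).
have := modulus_tri _ 0 s (y + b * y ^+ 2); rewrite subr0 sub0r modulusN.
have := modulus_tri _ s (y + b * y ^+ 2) 0; rewrite !subr0.
rewrite (modulusBC _ (y + _)) modulusM modulusX.
lra.
Qed.

Lemma blowup_full p : p != 0 -> blowup p.
Proof.
move=> p0; apply: contrapT => nTp.
have [t0 Tt0 t00] := blowup_nontrivial.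
have [s Ts near] := exists_nearest _ _ _ p blowup_closed Tt0.
(* From 0 one can move by 2^-k lam^j t0 without error, so 0 is not nearest: [descent] applies with K
   = 0. *)
have s0 : s != 0.
  apply/eqP => s0; move: near; rewrite s0 subr0 => near.
  have pc : t0 * p^* != 0 by rewrite mulf_neq0// conjc_eq0.
  have [j Hj] := exists_Re_mul_expr_gt0 _ _ _ lamIm pc.
  have [||k Hk] := @descent _ p (lam ^+ j * t0) 0.
  - by move: Hj; rewrite mulrC mulrA.
  - by [].
  have := Hk k (leqnn _); rewrite mul0r addr0 ltNge.
  by rewrite near//; apply/blowup_pow2V/blowup_lamX.
have v0 : p - s != 0 by rewrite subr_eq0; apply/eqP => ps; apply: nTp; rewrite ps.
have pc : tcoef * s ^+ 2 * (p - s)^* != 0.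
  by rewrite !mulf_neq0// ?tcoef_neq0 ?expf_neq0// conjc_eq0.
have [j Hj] := exists_Re_mul_expr_gt0 _ _ _ lamIm pc.
have [r [C [r0 C0 H]]] := blowup_step.
have lj0 : 0 < N lam ^+ j by rewrite exprn_gt0// modulus_gt0.
pose K := C * (N lam ^+ j) ^+ 2 * N s ^+ 3.
have K0 : 0 <= K by rewrite mulr_ge0 ?exprn_ge0 ?modulus_ge0// mulr_ge0 ?sqr_ge0.
have [||k0 Hk] := @descent _ (p - s) (lam ^+ j * (tcoef * s ^+ 2)) K.
- by rewrite -mulrA mulrC.
- by [].
(* [k1] brings the scaled point t = 2^-k lam^j s into the range of [blowup_step]. Scaling back by
   2^k lam^(-j) turns tcoef t^2 into 2^-k lam^j tcoef s^2 and the cubic error into K 4^-k. *)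
have [k1 Hk1] := @exists_expn2_gt R (N lam ^+ j * N s / r).
pose k := (k0 + k1)%N.
have := Hk k (leq_addr _ _); have := Hk1 k (leq_addl _ _).
set P2 := 2 ^+ k; rewrite ltr_pdivrMr// => h1.
have P20 : 0 < P2 by rewrite exprn_gt0.
pose t : R[i] := 2 ^- k * (lam ^+ j * s).
have tN : N t = N lam ^+ j * N s / P2.
  by rewrite /t modulusM modulusV modulusX modulus_nat modulusM modulusX mulrC.
have q0 : (2 : R[i]) ^+ k != 0 by rewrite expf_neq0// pnatr_eq0.
have l0 : lam ^+ j != 0 by rewrite expf_neq0.
have [|||s1 Ts1 hs1] := H t.
- exact/blowup_pow2V/blowup_lamX.
- by rewrite !mulf_neq0// invr_neq0.
- by rewrite tN ler_pdivrMr//; lra.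
pose s' := 2 ^+ k * (lam ^- j * s1).
have Ts' : blowup s' by exact/blowup_pow2/blowup_lamVX.
have hs' : N (s' - s - 2 ^- k * (lam ^+ j * (tcoef * s ^+ 2))) <= K * P2^-1 ^+ 2.
  rewrite (_ : _ - _ = 2 ^+ k * (lam ^- j * (s1 - t - tcoef * t ^+ 2))); last first.
    by rewrite /s' /t; field; rewrite q0 l0.
  rewrite modulusM modulusX modulus_nat -/P2 modulusM modulusV modulusX.
  rewrite tN in hs1.
  rewrite -ler_pdivlMl// ler_pdivrMl//; apply: (le_trans hs1).
  rewrite le_eqVlt; apply/orP; left; apply/eqP; rewrite /K; field.
  by rewrite gt_eqF.
move=> h2; have := near _ Ts'.
have := modulusB_le _ (p - s - 2 ^- k * (lam ^+ j * (tcoef * s ^+ 2)))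
   (s' - s - 2 ^- k * (lam ^+ j * (tcoef * s ^+ 2))).
rewrite (_ : _ - _ - _ = p - s'); last by ring.
move: h2; rewrite -/P2; lra.
Qed.

End Blowup.

(** * Iterated square roots *)

Section Roots.
Variable R : realType.
Implicit Types (w v : R[i]).

Lemma Re_sqrtc_ge0 w : 0 <= complex.Re (sqrtc w).
Proof. by case: w => a b /=; rewrite sqrtr_ge0. Qed.

Lemma modulus_sqrtcB1 w : N (sqrtc w - 1) * N (sqrtc w + 1) = N (w - 1).
Proof. by rewrite -modulusM -{3}(sqr_sqrtc w); congr N; ring. Qed.

Lemma modulus_sqrtcD1_ge1 w : 1 <= N (sqrtc w + 1).
Proof.
apply: le_trans (le_trans (ler_norm _) (Re_le_modulus _ _)).
by rewrite raddfD/= lerDr Re_sqrtc_ge0.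
Qed.

Lemma modulus_sqrtcB1_le w : N (sqrtc w - 1) <= N (w - 1).
Proof.
by rewrite -(modulus_sqrtcB1 w) ler_peMr ?modulus_ge0 ?modulus_sqrtcD1_ge1.
Qed.

(** As Re w = Re(sqrt w)^2 - Im(sqrt w)^2 is nonnegative, at least half of |sqrt w|^2 comes from the
    real part. *)
Lemma modulus_sqrtcD1_ge w (mu : R) : 0 <= complex.Re w -> 0 < mu <= 1 ->
  mu <= N (sqrtc w) -> 1 + mu / 2 <= N (sqrtc w + 1).
Proof.
move=> w0 /andP[m0 m1] hm.
have hw : complex.Re w = complex.Re (sqrtc w) ^+ 2 - complex.Im (sqrtc w) ^+ 2.
  by rewrite -{1}(sqr_sqrtc w); case: (sqrtc w) => a b /=; ring.
have hn := modulus_sqr _ (sqrtc w); have r0 := Re_sqrtc_ge0 w.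
apply: le_trans (le_trans (ler_norm _) (Re_le_modulus _ _)).
rewrite raddfD/= addrC lerD2r.
have : mu ^+ 2 <= N (sqrtc w) ^+ 2 by rewrite ler_pXn2r ?nnegrE ?modulus_ge0// ltW.
rewrite hn => h.
rewrite -(@ler_pXn2r _ 2)// ?nnegrE//; last by lra.
rewrite expr_div_n; have := sqr_ge0 mu; lra.
Qed.

(** Raising to the power 2^k magnifies errors near 1 by about 2^k, so an error of order |v - 1|^2
    must survive that factor. Each square root divides the distance to 1 by |sqrt w + 1|: first by
    at least c > 1, then, once within 1/4 of 1, by at least 3/2, and 2 (2/3)^2 = 8/9 < 1. *)
Lemma exists_pow2_root_near1 (W : R[i]) (eps : R) : W != 0 -> 0 < eps ->
  exists k v, [/\ v ^+ (2 ^ k) = W, N (v - 1) <= 4^-1 & 2 ^+ k * N (v - 1) ^+ 2 < eps].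
Proof.
move=> W0 e0.
pose r k := iter k (@sqrtc R) W.
have rW k : r k ^+ (2 ^ k) = W.
  by elim: k => [|k IH]; rewrite /r ?expn0 ?expr1// iterS expnS exprM sqr_sqrtc.
pose mu := Num.min (N W) 1.
have mu0 : 0 < mu by rewrite lt_min ltr01 modulus_gt0 W0.
have mu1 : mu <= 1 by rewrite ge_min lexx orbT.
have rmu k : mu <= N (r k).
  rewrite leNgt; apply/negP => h.
  have : N (r k) ^+ (2 ^ k) < mu.
    rewrite (le_lt_trans _ h)// -(prednK (expn_gt0 2 k)) exprS ler_piMr ?modulus_ge0//.
    by rewrite exprn_ile1 ?modulus_ge0//; lra.
  by rewrite -modulusX rW lt_min ltxx.
pose c := 1 + mu / 2.
have c1 : 1 < c by rewrite /c; lra.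
(* The decay starts at index 1: W may have negative real part, but every later term is a principal
   root. *)
have decay k : N (r k.+1 - 1) <= c^-1 ^+ k * N (r 1%N - 1).
  elim: k => [|k IH]; first by rewrite expr0 mul1r.
  have E := modulus_sqrtcB1 (r k.+1).
  have h : c <= N (r k.+2 + 1).
    apply: modulus_sqrtcD1_ge; rewrite ?mu0 ?mu1//; first exact: Re_sqrtc_ge0.
    exact: (rmu k.+2).
  rewrite exprS -mulrA ler_pdivlMl; last by lra.
  apply: le_trans IH; rewrite -E mulrC ler_wpM2l ?modulus_ge0//.
have [n0 Hn0] := expr_lt_eps _ c^-1 (4^-1 / (N (r 1%N - 1) + 1))
   ltac:(by rewrite invr_ge0; lra) ltac:(by rewrite invf_lt1; lra)
   ltac:(by rewrite divr_gt0//; have := modulus_ge0 _ (r 1%N - 1); lra).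
pose K := n0.+1.
have rK : N (r K - 1) <= 4^-1.
  have := Hn0 n0 (leqnn _); have d0 := modulus_ge0 _ (r 1%N - 1).
  rewrite ltr_pdivlMr; last by lra.
  have : 0 <= c^-1 ^+ n0 by rewrite exprn_ge0// invr_ge0; lra.
  have := decay n0; rewrite -/K; lra.
have fast j : N (r (j + K)%N - 1) <= (2 / 3) ^+ j * 4^-1.
  elim: j => [|j IH]; first by rewrite expr0 mul1r.
  have j1 : (2 / 3 : R) ^+ j <= 1 by rewrite exprn_ile1//; lra.
  have E := modulus_sqrtcB1 (r (j + K)%N).
  have h1 := modulus_sqrtcB1_le (r (j + K)%N).
  rewrite addSn [r _]/(sqrtc (r (j + K)%N)).
  set s := sqrtc _ in E h1 *.
  have h2 : 3 / 2 <= N (s + 1).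
    have := modulusB_ge _ 2 (1 - s); rewrite modulus_nat (modulusBC _ 1).
    rewrite (_ : 2 - (1 - s) = s + 1); last by ring.
    by lra.
  have : N (s - 1) * (3 / 2) <= N (s - 1) * N (s + 1) by rewrite ler_wpM2l ?modulus_ge0.
  rewrite exprS; lra.
have [j0 Hj0] := expr_lt_eps _ (8 / 9) (eps / 2 ^+ K) ltac:(lra) ltac:(lra)
  ltac:(by rewrite divr_gt0// exprn_gt0).
exists (j0 + K)%N, (r (j0 + K)%N); split; first exact: rW.
  by apply: (le_trans (fast _)); rewrite ler_piMl// exprn_ile1//; lra.
have := Hj0 j0 (leqnn _); rewrite ltr_pdivlMr ?exprn_gt0//; apply: le_lt_trans.
have := fast j0; set d := N _ => hd.
have d0 : 0 <= d by exact: modulus_ge0.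
have d2 : d ^+ 2 <= (4 / 9) ^+ j0.
  apply: (@le_trans _ _ (((2 / 3) ^+ j0) ^+ 2)).
    have p0 : 0 <= (2 / 3 : R) ^+ j0 by rewrite exprn_ge0//; lra.
    by rewrite ler_pXn2r ?nnegrE//; lra.
  by rewrite -exprM mulnC exprM (_ : (2 / 3) ^+ 2 = 4 / 9)//; field.
rewrite (_ : 8 / 9 = 2 * (4 / 9)); last by field.
rewrite exprMn exprD mulrAC ler_wpM2r ?exprn_ge0// ler_wpM2l// exprn_ge0//.
Qed.

End Roots.

(** * Density of the orbit *)

Section Orbit.
Variable R : realType.
Implicit Types (y z s t : R[i]).
Variables (lam : R[i]) (A : R[i] -> Prop).
Hypothesis lamIm : complex.Im lam != 0.
Hypothesis lam1 : N lam < 1.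
Hypothesis Af : forall y, A y -> A (f0C y).
Hypothesis Ag : forall y, A y -> y != -1 -> A (f1C lam y).

Let lam0 : lam != 0.
Proof. by apply: contraNneq lamIm => ->. Qed.

Let A_iter n y : A y -> A (iter n f0C y).
Proof. by move=> Ay; elim: n => //= n; exact: Af. Qed.

Lemma f1C_neq0 z : z != 0 -> z != -1 -> f1C lam z != 0.
Proof.
move=> z0 zN1; rewrite /f1C mulf_neq0// mulf_neq0// invr_neq0// expf_neq0//.
by rewrite addr_eq0.
Qed.

(** The iterates of f_0 escape to infinity, near which f_1 takes values near 0. *)
Lemma orbit_small_outside z : A z -> 1 < N (1 + z) ->
  forall eps : R, 0 < eps -> exists y, [/\ A y, y != 0 & N y < eps].
Proof.
move=> Az w1 eps e0.
pose B := Num.min eps 2 / 2.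
have B0 : 0 < B by rewrite divr_gt0// lt_min e0 ltr0n.
have wp : 0 < N (1 + z) by lra.
have [n Hn] := expr_lt_eps _ (N (1 + z))^-1 B ltac:(by rewrite invr_ge0 ltW)
  ltac:(by rewrite invf_lt1) B0.
pose x := iter n f0C z; pose W := (1 + z) ^+ (2 ^ n).
have xW : x + 1 = W by rewrite /x iter_f0CE subrK.
have WB : (N W)^-1 < B.
  by rewrite modulusX -exprVn Hn// ltnW// ltn_expl.
have Wp : 0 < N W by rewrite modulusX exprn_gt0.
have B1 : B <= 1 by rewrite ler_pdivrMr// mul1r ge_min lexx orbT.
have Be : 2 * B <= eps by rewrite /B mulrC divfK// ge_min lexx.
have W1 : 1 < N W.
  by have : (N W)^-1 < 1 by [lra]; rewrite invf_lt1.
have W0 : W != 0 by rewrite -modulus_gt0.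
have x0 : x != 0.
  by apply: contraTneq W1 => x0; rewrite -xW x0 add0r modulus1 ltxx.
exists (f1C lam x); split.
- apply: Ag; first exact: A_iter.
  by rewrite -addr_eq0 xW.
- by rewrite f1C_neq0// -addr_eq0 xW.
rewrite /f1C xW !modulusM modulusV modulusX.
have xN : N x <= 2 * N W.
  rewrite -[x](addrK 1) xW; apply: (le_trans (modulusB_le _ _ _)).
  by rewrite modulus1; lra.
have h : N x / N W ^+ 2 <= 2 * (N W)^-1.
  rewrite ler_pdivrMr ?exprn_gt0// (_ : 2 * _ * _ = 2 * N W)//.
  by field; rewrite gt_eqF.
have : N lam * (N x / N W ^+ 2) <= 1 * (2 * (N W)^-1).
  apply: ler_pM; rewrite ?modulus_ge0 ?(ltW lam1)//.
  by rewrite divr_ge0 ?exprn_ge0 ?modulus_ge0.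
lra.
Qed.

(** The iterates of f_0 tend to -1 without reaching it; f_1 has its pole there and throws them
    outside the circle. *)
Lemma orbit_small_inside z : A z -> z != -1 -> N (1 + z) < 1 ->
  forall eps : R, 0 < eps -> exists y, [/\ A y, y != 0 & N y < eps].
Proof.
move=> Az zN1 w1.
have w0 : 1 + z != 0 by rewrite addrC addr_eq0.
have q0 : 0 < N lam by rewrite modulus_gt0.
have l1 := lam1.
(* Below |lam| / 4, the value |lam| |x| / |W|^2 exceeds 2, hence |1 + f_1(x)| > 1. *)
have [n Hn] := expr_lt_eps _ (N (1 + z)) (N lam / 4) (modulus_ge0 _ _) w1
  ltac:(by rewrite divr_gt0).
pose x := iter n f0C z; pose W := (1 + z) ^+ (2 ^ n).
have xW : x + 1 = W by rewrite /x iter_f0CE subrK.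
have W0 : W != 0 by rewrite expf_neq0.
have Wq : N W < N lam / 4 by rewrite modulusX Hn// ltnW// ltn_expl.
have Wp : 0 < N W by rewrite modulus_gt0.
apply: (@orbit_small_outside (f1C lam x)).
  by apply: Ag; [exact: A_iter|rewrite -addr_eq0 xW].
rewrite addrC.
have := modulusD_ge _ (f1C lam x) 1; rewrite modulus1; apply: lt_le_trans.
rewrite ltrBrDr /f1C xW !modulusM modulusV modulusX mulrA ltr_pdivlMr ?exprn_gt0//.
have : 1 - N W <= N x.
  by rewrite -[x](addrK 1) xW modulusBC; have := modulusB_ge _ 1 W; rewrite modulus1.
move=> h.
have : N lam * (1 - N W) <= N lam * N x by rewrite ler_wpM2l// ltW.
have : N W ^+ 2 <= N lam / 4 * 4^-1.
  by rewrite expr2; apply: ler_pM; rewrite ?ltW//; lra.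
have : N lam * N W <= N lam * 4^-1 by rewrite ler_wpM2l ?(ltW q0)//; lra.
lra.
Qed.

(* With w = 1 + z, the value is (w^2 - w - 1) / w^2, and on the unit circle
   |w^2 - w - 1| = |w - w^* - 1| > 1 unless w is real. *)
Lemma orbit_leaves_circle z : z != 0 -> N (1 + z) = 1 -> f1C lam z = -1 ->
  1 < N (1 + f1C lam (f0C z)).
Proof.
move=> z0 w1 fz.
set w := 1 + z in w1.
have w0 : w != 0 by rewrite -modulus_gt0 w1.
have zw : z = w - 1 by rewrite /w addrC addKr.
have lw : lam * (w - 1) = - w ^+ 2.
  have := congr1 (fun u => u * w ^+ 2) fz.
  by rewrite /f1C zw subrK mulrA divfK ?expf_neq0// mulN1r.
have E : 1 + f1C lam (f0C z) = (w ^+ 2 - w - 1) / w ^+ 2.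
  rewrite (_ : f1C lam (f0C z) = lam * (w - 1) * (w + 1) / w ^+ 4); last first.
    rewrite /f1C /f0C zw (_ : 2 * (w - 1) + (w - 1) ^+ 2 + 1 = w ^+ 2); last by ring.
    by field.
  by rewrite lw; field.
rewrite E modulusM modulusV modulusX w1 expr1n invr1 mulr1.
have w2 := modulus_sqr _ w; rewrite w1 expr1n in w2.
(* A real w on the unit circle is 1, excluded by z != 0, or -1, which would make lam = 1/2 real. *)
have b0 : complex.Im w != 0.
  apply/eqP => b0; rewrite b0 expr0n addr0 in w2.
  have wR : w = (complex.Re w)%:C by move: b0; case: (w) => a b /= ->.
  have [a1|a1] : complex.Re w = 1 \/ complex.Re w = -1.
    have /eqP : (complex.Re w - 1) * (complex.Re w + 1) = 0.
      by rewrite -subr_sqr expr1n -w2 subrr.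
    by rewrite mulf_eq0 subr_eq0 addr_eq0 => /orP[/eqP|/eqP]; [left|right].
  - by move/eqP: z0; apply; rewrite zw wR a1 subrr.
  - move/eqP: lamIm; apply.
    have im (l : R[i]) : l * (- 1 - 1) = - (- 1) ^+ 2 -> complex.Im l = 0.
      by case: l => a b /(congr1 (@complex.Im R)) /=; lra.
    by apply: im; move: lw; rewrite wR a1 rmorphN1.
have -> : w ^+ 2 - w - 1 = w * Complex (-1) (2 * complex.Im w).
  move: w2; case: (w) => a b /= w2; apply/eqP; rewrite eq_complex /=.
  by apply/andP; split; apply/eqP; lra.
rewrite modulusM w1 mul1r.
rewrite -(@ltr_pXn2r _ 2)// ?nnegrE ?modulus_ge0// modulus_sqr/= expr1n sqrrN expr1n ltrDl.
by rewrite exprn_even_gt0//= mulf_neq0.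
Qed.

(* On the unit circle |1 + z| = 1, f_1 multiplies |z| by |lam|. *)
Lemma orbit_small z : A z -> z != 0 -> z != -1 ->
  forall eps : R, 0 < eps -> exists y, [/\ A y, y != 0 & N y < eps].
Proof.
move=> Az z0 zN1 eps e0; apply: contrapT => H.
(* Under the negated conclusion, every point of A other than -1 is confined to the circle. *)
have circ y : A y -> y != -1 -> N (1 + y) = 1.
  move=> Ay yN1; case: (ltgtP (N (1 + y)) 1) => // h; exfalso; apply: H.
    exact: orbit_small_inside Ay yN1 h eps e0.
  exact: orbit_small_outside Ay h eps e0.
have step n : exists y, [/\ A y, y != 0, y != -1 & N y <= N lam ^+ n * N z].
  elim: n => [|n [y [Ay y0 yN1 yn]]]; first by exists z; rewrite expr0 mul1r.
  have w1 := circ y Ay yN1.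
  have w0 : y + 1 != 0 by rewrite addr_eq0.
  exists (f1C lam y); split.
  - exact: Ag.
  - exact: f1C_neq0.
  (* If f_1 sends y to the pole, the detour through f_0(y) leaves the circle on the outside. *)
  - apply/eqP => gy; apply: H.
    apply: (@orbit_small_outside (f1C lam (f0C y))) => //; last first.
      exact: orbit_leaves_circle.
    apply: Ag; first exact: Af.
    rewrite -addr_eq0 (_ : f0C y + 1 = (y + 1) ^+ 2) ?expf_neq0//.
    by rewrite /f0C; ring.
  - rewrite /f1C !modulusM modulusV modulusX (addrC y) w1 expr1n invr1 mulr1 exprS -mulrA.
    by rewrite ler_wpM2l ?modulus_ge0.
have zp : 0 < N z by rewrite modulus_gt0.
have [n Hn] := expr_lt_eps _ (N lam) (eps / N z) (modulus_ge0 _ _) lam1 ltac:(by rewrite divr_gt0).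
have [y [Ay y0 _ yn]] := step n; apply: H; exists y; split => //.
by apply: (le_lt_trans yn); rewrite -ltr_pdivlMr// Hn.
Qed.

(** For a root v of W of order 2^k near 1, the blow-up supplies 2^m y close to v - 1, so (1 +
    y)^(2^m) is v up to O(|v - 1|^2); its power 2^k is close to W. The conclusion ends with an
    application of f_0 because A will contain the starting point itself. *)
Lemma orbit_dense z W (eps : R) : A z -> z != 0 -> z != -1 ->
  W != 0 -> W != 1 -> 0 < eps -> exists2 y, A y & N (f0C y - (W - 1)) < eps.
Proof.
move=> Az z0 zN1 W0 W1 e0.
have Wp : 0 < N W by rewrite modulus_gt0.
(* The relative error d below satisfies 2^k |d| <= 10 e1: the bound 1/20 makes this at most 1/2 for
   [expD1_est1], the other bound makes the final error less than eps. *)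
pose e1 := Num.min 20^-1 (eps / (20 * N W)).
have e10 : 0 < e1 by rewrite lt_min invr_gt0 ltr0n/= divr_gt0// mulr_gt0.
have [k [v [vW v4]]] := exists_pow2_root_near1 _ W e1 W0 e10.
rewrite lt_min => /andP[h1 h2].
have tau0 : v - 1 != 0.
  by apply: contraNneq W1 => /eqP; rewrite subr_eq0 -vW => /eqP ->; rewrite expr1n.
have Ttau := blowup_full _ _ _ lam0 lam1 Af Ag lamIm (orbit_small _ Az z0 zN1) _ tau0.
set tau := v - 1 in v4 h1 h2 tau0 Ttau.
have taup : 0 < N tau by rewrite modulus_gt0.
have e20 : 0 < N tau ^+ 2 by rewrite exprn_gt0.
(* Asking for m >= 1 leaves one iterate of f_0 to split off at the end. *)
have [m [y [mk Ay h]]] := Ttau _ 1%N e20.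
have tau2 : N tau ^+ 2 <= N tau / 4 by rewrite expr2 ler_wpM2l// ltW.
set Y := 2 ^+ m * y in h.
have Yt : N Y <= 2 * N tau.
  by have := modulus_tri _ tau Y 0; rewrite !subr0; lra.
have YE : N Y = (2 ^ m)%:R * N y by rewrite /Y modulusM modulusX modulus_nat natrX.
have hY : (2 ^ m)%:R * N y <= 2^-1 by rewrite -YE; lra.
have := expD1_est2 _ y (2 ^ m) hY; rewrite -YE natrX -/Y.
set x := (1 + y) ^+ _ => E.
have Y2 : N Y ^+ 2 <= 4 * N tau ^+ 2.
  rewrite (_ : 4 * _ = (2 * N tau) ^+ 2); last by ring.
  by rewrite ler_pXn2r ?nnegrE ?modulus_ge0// mulr_ge0// ltW.
have xv : N (x - v) <= 5 * N tau ^+ 2.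
  rewrite (_ : x - v = (x - 1 - Y) + (Y - tau)); last by rewrite /tau; ring.
  by apply: (le_trans (modulusD_le _ _ _)); lra.
have v2 : 2^-1 <= N v.
  have := modulusB_ge _ 1 (1 - v); rewrite modulus1 (modulusBC _ 1 v).
  by rewrite (_ : 1 - (1 - v) = v); [lra|ring].
have v0 : v != 0 by rewrite -modulus_gt0; lra.
pose d := (x - v) / v.
have d10 : N d <= 10 * N tau ^+ 2.
  by rewrite modulusM modulusV ler_pdivrMr; [nra|lra].
have xd : x = v * (1 + d) by rewrite /d; field.
have xE : x = (1 + y) ^+ (2 ^ m) by [].
clearbody d x.
have kd : (2 ^ k)%:R * N d <= 10 * (2 ^+ k * N tau ^+ 2).
  by rewrite natrX mulrCA ler_wpM2l// exprn_ge0.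
have kd2 : (2 ^ k)%:R * N d <= 2^-1 by lra.
have E1 := expD1_est1 _ d (2 ^ k) kd2.
exists (iter (m + k).-1 f0C y); first exact: A_iter.
have mk0 : (0 < m + k)%N by rewrite addn_gt0 mk.
rewrite -iterS prednK// iter_f0CE expnD exprM -xE xd exprMn vW.
rewrite (_ : _ - _ = W * ((1 + d) ^+ (2 ^ k) - 1)); last by ring.
rewrite modulusM.
have : N W * N ((1 + d) ^+ (2 ^ k) - 1) <= N W * (20 * (2 ^+ k * N tau ^+ 2)).
  by rewrite ler_wpM2l ?modulus_ge0//; lra.
move: h2; rewrite ltr_pdivlMr; last by rewrite mulr_gt0.
lra.
Qed.

End Orbit.

(** * Passage from the plane to the Riemann sphere *)

Lemma complex_not_compact (R : realType) : ~ compact [set: R[i]^o].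
Proof.
move=> cpt.
pose u (n : nat) : R[i]^o := n%:R.
have uT : (u @ \oo) [set: R[i]^o] by exists 0%N.
have [z [_ cl]] := cpt _ _ uT.
have [n0 Hn0] := @exists_expn2_gt R (N z + 1).
have tl : (u @ \oo) (u @` [set n | (2 ^ n0 <= n)%N]).
  by exists (2 ^ n0)%N => // n /= Mn; exists n.
have [_ [[n /= nn0 <-]]] := cl _ _ tl (nbhsx_ballx z (1 : R[i]) ltr01).
rewrite -ball_normE /= normC_modulus ltcR => h.
have : N z + 1 < n%:R.
  by rewrite (lt_le_trans (Hn0 n0 (leqnn _)))// -natrX ler_nat.
have := modulus_tri _ z (u n) 0; rewrite !subr0 modulus_nat (modulusBC _ (u n)).
set a := n%:R; lra.
Qed.

(** A neighbourhood of infinity contains the complement of a compact set, which is nonempty as the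
    plane is not compact. Hence density need only be checked near finite points. *)
Lemma sphere_open_ball (R : realType) (O : set (riemann_sphere R)) :
  O !=set0 -> open O -> exists (c : R[i]) (eps : R), 0 < eps /\
    forall z : R[i], N (z - c) < eps -> O (Some z).
Proof.
move=> [p Op] oO.
have [c Oc] : exists c : R[i]^o, O (Some c).
  case: p Op => [c Oc|ON]; first by exists c.
  have : nbhs (None : riemann_sphere R) O by exact: open_nbhs_nbhs.
  move=> [W [cW _] WO]; apply: contrapT => /forallNP H.
  apply: (@complex_not_compact R); rewrite (_ : setT = W)//.
  apply/seteqP; split => // z _; apply: contrapT => nWz.
  by apply: (H z); apply: WO; left; exists z.
have : nbhs (Some c : riemann_sphere R) O by exact: open_nbhs_nbhs.
rewrite /nbhs /= => -[e /= e0 eO].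
(* The radius is a positive element of [R[i]], hence real; its real part serves as eps. *)
move: e0; rewrite ltcE /= => /andP[/eqP ei er].
exists c, (complex.Re e); split => // z zc.
apply: eO; rewrite /ball_/= normC_modulus modulusBC.
by rewrite ltcE /= -ei eqxx.
Qed.

Theorem theorem3p3 (R : realType) (lambda z0 : R[i]) :
  `|lambda| < 1 -> lambda \isn't Num.real ->
  z0 != -1 -> z0 != 0 ->
  dense (orbit_of (semigroup_generated [set @f0 R; f1 lambda])
                  (Some z0 : riemann_sphere R)).
Proof.
rewrite normC_modulus ltcR => lam1 lamR zN1 z00 O On0 oO.
have lamIm : complex.Im lambda != 0.
  by apply: contra lamR; case: (lambda) => a b /=; rewrite complex_real.
have [c [eps [e0 cO]]] := sphere_open_ball _ _ On0 oO.
pose G := semigroup_generated [set @f0 R; f1 lambda].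
(* The identity is not among the generators of G, so z0 is adjoined to its orbit by hand; by [Af'],
   applying f_0 always lands in the orbit proper. *)
pose A y := y = z0 \/ orbit_of G (Some z0 : riemann_sphere R) (Some y).
have Af' y : A y -> orbit_of G (Some z0 : riemann_sphere R) (Some (f0C y)).
  have Gf0 : G (@f0 R) by apply: semigroup_gen; left.
  case=> [->|[g Gg gy]]; first by exists (@f0 R); rewrite // f0E.
  by exists (@f0 R \o g); [exact: semigroup_comp|rewrite /= gy f0E].
have Ag y : A y -> y != -1 -> A (f1C lambda y).
  have Gf1 : G (f1 lambda) by apply: semigroup_gen; right.
  move=> Ay yN1; right; case: Ay => [e|[g Gg gy]].
    by subst y; exists (f1 lambda); rewrite // f1E.
  by exists (f1 lambda \o g); [exact: semigroup_comp|rewrite /= gy f1E].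
have Af y : A y -> A (f0C y) by move=> /Af'; right.
pose d : R := Num.min (eps / 2) 2^-1.
have d0 : 0 < d by rewrite lt_min invr_gt0 ltr0n divr_gt0.
(* The targets c = -1 and c = 0 are not covered by [orbit_dense]; a shift by d in (0, 1/2] turns W
   into d or 1 + d. *)
have [W [W0 W1 Wc]] : exists W : R[i], [/\ W != 0, W != 1 & N (W - 1 - c) <= eps / 2].
  have [cc|] := boolP ((1 + c == 0) || (1 + c == 1)).
    have d1 : d <= eps / 2 by rewrite ge_min lexx.
    have d2 : d <= 2^-1 by rewrite ge_min lexx orbT.
    exists (1 + c + d%:C); split; last first.
      rewrite (_ : _ - _ = d%:C); last by ring.
      by rewrite /modulus /= expr0n addr0 sqrtr_sqr ger0_norm// ltW.
    - apply/eqP => /(congr1 (@complex.Re R)).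
      by case/orP: cc => /eqP ->; rewrite /=; lra.
    - apply/eqP => /(congr1 (@complex.Re R)).
      by case/orP: cc => /eqP ->; rewrite /=; lra.
  rewrite negb_or => /andP[c0 c1]; exists (1 + c); split => //.
  by rewrite (_ : _ - _ = 0) ?modulus0; [lra|ring].
have e20 : 0 < eps / 2 by lra.
have [y Ay h] := orbit_dense _ _ _ lamIm lam1 Af Ag _ _ _ (or_introl erefl : A z0) z00 zN1 W0 W1 e20.
exists (Some (f0C y)); split; last exact: Af'.
apply: cO; have := modulus_tri _ (W - 1) (f0C y) c; lra.
Qed.
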